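(* Let $X,Y$ be normed spaces, $q>0$, $S:Y\rightrightarrows X$ a set-valued mapping and $(\bar y,\bar x)\in\mathrm{gph}\,S$. Consider the following conditions: (i) $S$ possesses the $q$-order isolated calmness property at $(\bar y,\bar x)$; (ii) $\|D_{\frac1q}S(\bar y,\bar x)\|^+_{\frac1q}<+\infty$; (iii) $D_{\frac1q}S(\bar y,\bar x)(0)=\{0\}$. Then (i) $\Rightarrow$ (ii) $\Rightarrow$ (iii). If $\dim X<+\infty$ and $\dim Y<+\infty$, then (i) $\Leftrightarrow$ (ii) $\Leftrightarrow$ (iii).
   Context: A set-valued mapping $S:Y\rightrightarrows X$ assigns to each $y\in Y$ a (possibly empty) subset $S(y)\subset X$; $\mathrm{gph}\,S=\{(y,x): x\in S(y)\}$. $S$ possesses the $q$-order isolated calmness property at $(\bar y,\bar x)\in\mathrm{gph}\,S$ if there exist $\tau>0$ and neighbourhoods $U$ of $\bar x$ and $V$ of $\bar y$ such that $\tau\|x-\bar x\|^q\le\|y-\bar y\|$ for all $y\in V$ and $x\in S(y)\cap U$. For $r>0$, the $r$-order graphical derivative $D_rS(\bar y,\bar x):Y\rightrightarrows X$ is defined by: $x\in D_rS(\bar y,\bar x)(y)$ iff there exist $(y_k,x_k)\to(y,x)$ and $t_k\downarrow0$ with $(\bar y+t_ky_k,\bar x+t_k^rx_k)\in\mathrm{gph}\,S$ for all $k\in\mathbb N$. A mapping $H:Y\rightrightarrows X$ is $r$-order positively homogeneous if $0\in H(0)$ and $H(\lambda y)=\lambda^rH(y)$ for all $y\in Y$, $\lambda>0$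 ($D_rS(\bar y,\bar x)$ is such a mapping). For such $H$, $\|H\|^+_r:=\sup_{(y,x)\in\mathrm{gph}\,H\setminus\{(0,0)\}}\|x\|/\|y\|^r\in[0,+\infty]$, with $a/0=+\infty$ for $a>0$ and $\sup\emptyset=0$. *)

(* Defs.v *)
(* MathComp-Analysis *)
From HB Require Import structures.
From mathcomp Require Import all_boot all_order all_algebra.
From mathcomp Require Import all_classical all_reals all_analysis.
Set Implicit Arguments.
Unset Strict Implicit.
Unset Printing Implicit Defensive.
Import Order.TTheory GRing.Theory Num.Theory.
Import numFieldNormedType.Exports.
Local Open Scope classical_set_scope.
Local Open Scope ring_scope.

(* A set-valued mapping from Y to X is a function Y -> set X, possibly with
   empty values. *)
Definition gph (X Y : Type) (S : Y -> set X) : set (Y * X) :=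
  [set p | S p.1 p.2].

Definition isolated_calmness (R : realType) (X Y : normedModType R) (q : R)
    (S : Y -> set X) (ybar : Y) (xbar : X) : Prop :=
  exists2 tau : R, 0 < tau &
  exists (U : set X) (V : set Y), [/\ nbhs xbar U, nbhs ybar V &
    forall y x, V y -> (S y `&` U) x ->
      tau * `|x - xbar| `^ q <= `|y - ybar|].

(* "t_k decreases to 0" is read as t_k > 0 and t_k --> 0; passing to
   subsequences, requiring monotonicity gives the same mapping. *)
Definition graph_deriv (R : realType) (X Y : normedModType R) (r : R)
    (S : Y -> set X) (ybar : Y) (xbar : X) : Y -> set X :=
  fun y => [set x | exists (y_ : nat -> Y) (x_ : nat -> X) (t_ : nat -> R),
    [/\ y_ @ \oo --> y, x_ @ \oo --> x,
        (forall k, 0 < t_ k), t_ @ \oo --> (0 : R) &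
        forall k, gph S (ybar + t_ k *: y_ k, xbar + (t_ k `^ r) *: x_ k)]].

(* The inverse of 0 in \bar R is +oo, so the quotient is +oo when y = 0 and
   x != 0 (for r > 0).  The element 0 is added because ereal_sup set0 = -oo;
   it changes nothing when the graph contains a pair other than (0, 0). *)
Definition outer_norm (R : realType) (X Y : normedModType R) (r : R)
    (H : Y -> set X) : \bar R :=
  ereal_sup ([set 0%E] `|`
    [set (`|p.2|%:E / (`|p.1| `^ r)%:E)%E | p in gph H `\ (0, 0)]).

Definition finite_dim (R : realType) (V : normedModType R) : Prop :=
  exists n : nat, inhabited (Vector.axiom n V).

(* Main.v *)
Require Import Defs.
From HB Require Import structures.
From mathcomp Require Import all_boot all_order all_algebra.
From mathcomp Require Import all_classical all_reals all_analysis.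
Import Order.TTheory GRing.Theory Num.Theory.
Import numFieldNormedType.Exports.
Local Open Scope classical_set_scope.
Local Open Scope ring_scope.

(** Calmness survives blowing up: with [x = xbar + t_k^(1/q) x_k] and [y = ybar + t_k y_k], both
    sides of the calmness inequality scale by [t_k], so the limit gives [tau |x|^q <= |y|] on the
    graph of the derivative ([isolated_calmness_graph_deriv]). This bounds every quotient in the
    outer norm by [(1/tau)^(1/q)], hence (i) gives (ii). A nonzero [x] in the derivative at 0 would
    contribute the quotient [|x|/0 = +oo], hence (ii) gives (iii). For (iii) to (i), points
    violating calmness are rescaled to unit directions in [X]; compactness of the unit sphere
    ([finite_dim_sphere_compact]) yields a limit direction of norm 1 in the derivative at 0,
    contradicting (iii). *)

Lemma linear_rV_continuous (R : realType) (X : normedModType R) (n : nat)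
    (g : {linear 'rV[R]_n -> X}) : continuous g.
Proof.
have -> : (g : 'rV[R]_n -> X) = fun z => \sum_i z 0 i *: g (delta_mx 0 i).
  apply/funext => z; rewrite [in LHS](row_sum_delta z) linear_sum.
  by apply: eq_bigr => i _; rewrite linearZ.
move=> z; apply: (cvg_big add_continuous (F := nbhs z)) => i _.
by apply: cvgZr_tmp; exact: coord_continuous.
Qed.

Lemma norm_linear_rV_continuous (R : realType) (X : normedModType R) (n : nat)
    (g : {linear 'rV[R]_n -> X}) : continuous (fun z => `|g z|).
Proof.
move=> z.
have gz : g x @[x --> z] --> g z := @linear_rV_continuous _ _ _ g z.
exact: (cvg_norm gz).
Qed.

(** The constant is the minimum of [|g z|] on the compact unit sphere, positive by injectivity;
    homogeneity extends the bound to all [z]. *)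
Lemma linear_rV_lower_bound (R : realType) (X : normedModType R) (n : nat)
    (g : {linear 'rV[R]_n -> X}) : injective g ->
  exists2 c : R, 0 < c & forall z, c * `|z| <= `|g z|.
Proof.
move=> g_inj.
pose A : set 'rV[R]_n := [set z | `|z| = 1].
have AZ z : z != 0 -> A (`|z|^-1 *: z).
  by move=> z0; rewrite /A /= normrZ normfV normr_id mulVf ?normr_eq0.
(* If the sphere is empty, every vector is 0 and any constant works. *)
have [[a Aa]|A0] := pselect (A !=set0); last first.
  exists 1 => // z; have [->|z0] := eqVneq z 0; first by rewrite normr0 mulr0.
  by case: A0; exists (`|z|^-1 *: z); exact: AZ.
have cA : compact A.
  apply: bounded_closed_compact.
    by exists 1; split => // M M1 z /= ->; exact: ltW.
  rewrite (_ : A = (fun z : 'rV[R]_n => `|z|) @^-1` [set 1]) //.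
  by apply: preimage_closed => [z _|]; [exact: norm_continuous|exact: closed_eq].
have cg : {within A, continuous (fun z => `|g z|)}.
  by apply: continuous_subspaceT; exact: norm_linear_rV_continuous.
have [c] := compact_EVT_min (ex_intro _ a Aa) cA cg.
rewrite inE => Ac cmin; exists `|g c|.
  rewrite normr_gt0 -(linear0 g) (inj_eq g_inj) -normr_eq0.
  by rewrite (Ac : `|c| = 1) oner_eq0.
move=> z; have [->|z0] := eqVneq z 0; first by rewrite normr0 mulr0.
have := cmin _ (mem_set (AZ _ z0)).
by rewrite linearZ normrZ normfV normr_id mulrC ler_pdivlMr ?normr_gt0.
Qed.

(** The sphere is the image, under the continuous inverse [g] of the coordinate map, of a set of row
    vectors that is closed by continuity and bounded by [c^-1] thanks to [linear_rV_lower_bound]. *)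
Lemma finite_dim_sphere_compact (R : realType) (X : normedModType R) :
  finite_dim X -> compact [set x : X | `|x| = 1].
Proof.
move=> [n [[f f_lin [h fK hK]]]].
pose fL : {linear X -> 'rV[R]_n} := HB.pack f (GRing.isLinear.Build _ _ _ _ f f_lin).
have h_lin : linear h := can2_linear (f := fL) fK hK.
pose g : {linear 'rV[R]_n -> X} := HB.pack h (GRing.isLinear.Build _ _ _ _ h h_lin).
have [c c0 cP] := @linear_rV_lower_bound _ _ _ g (can_inj hK).
have -> : [set x : X | `|x| = 1] = [set g z | z in [set z | `|g z| = 1]].
  rewrite predeqE => x; split => [x1|[z z1 <-//]].
  by exists (f x); rewrite /= fK.
apply: continuous_compact.
  by apply: continuous_subspaceT; exact: linear_rV_continuous.
apply: bounded_closed_compact.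
  exists c^-1; split; first exact: num_real.
  move=> M cM z /= z1; apply: ltW; apply: le_lt_trans cM.
  by rewrite -[leRHS]mul1r ler_pdivlMr// mulrC -z1.
rewrite (_ : mkset _ = (fun z => `|g z|) @^-1` [set 1]) //.
apply: preimage_closed => [z _|]; last exact: closed_eq.
exact: norm_linear_rV_continuous.
Qed.

(** A cluster point [l] is approached by choosing [s k >= k] with [u (s k)] within [1/(k+1)] of [l].
    The map [s] may fail to be increasing; tending to infinity is enough to compose limits. *)
Lemma compact_subsequence (R : realType) (X : normedModType R) (K : set X)
    (u : nat -> X) : compact K -> (forall k, K (u k)) ->
  exists2 l, K l &
  exists2 s : nat -> nat, s @ \oo --> \oo & (u \o s) @ \oo --> l.
Proof.
move=> cK Ku.
have [l [Kl lcl]] : K `&` cluster (u @ \oo) !=set0.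
  by apply: cK; exists 0%N => // k _; exact: Ku.
exists l => //.
have /choice[s sP] k : exists m, (k <= m)%N /\ ball l k.+1%:R^-1 (u m).
  have [||_ [[m km <-] lm]] := lcl (u @` [set m | (k <= m)%N]) (ball l k.+1%:R^-1).
  - by exists k => // m km; exists m.
  - by apply: nbhsx_ballx; rewrite invr_gt0.
  - by exists m.
exists s.
  move=> B [N _ NB]; exists N => // k Nk; apply: NB => /=.
  by apply: leq_trans Nk _; case: (sP k).
apply/cvgrPdist_lt => e e0; near=> k.
have [_] := sP k; rewrite -ball_normE /= => /lt_trans; apply.
by near: k; exact: near_infty_natSinv_lt (PosNum e0).
Unshelve. all: by end_near. Qed.

Lemma cvg0_powR (R : realType) (t : nat -> R) (r : R) : 0 < r ->
  (forall k, 0 < t k) -> t @ \oo --> 0 -> t k `^ r @[k --> \oo] --> 0.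
Proof.
move=> r0 t_gt0 t_0.
have t_right : t @ \oo --> 0^'+.
  move=> B [e /= e0 eB]; move/cvgrPdist_lt : t_0 => /(_ e e0).
  by apply: filterS => k tk; exact: eB.
exact: (cvg_comp t (fun x => x `^ r) t_right (powR_cvg0 r0)).
Qed.

Section graphical_derivative.
Variables (R : realType) (X Y : normedModType R) (q : R).
Variables (S : Y -> set X) (ybar : Y) (xbar : X).
Hypothesis q_gt0 : 0 < q.

Let q_neq0 : q != 0. Proof. by rewrite gt_eqF. Qed.

Let q_ge0 : 0 <= q. Proof. exact: ltW. Qed.

Let qV_ge0 : 0 <= q^-1. Proof. by rewrite invr_ge0. Qed.

Let powRqK (t : R) : 0 <= t -> (t `^ q^-1) `^ q = t.
Proof. by move=> t0; rewrite -powRrM mulVf// powRr1. Qed.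

Let powRKq (t : R) : 0 <= t -> (t `^ q) `^ q^-1 = t.
Proof. by move=> t0; rewrite -powRrM mulfV// powRr1. Qed.

Lemma isolated_calmness_graph_deriv :
  isolated_calmness q S ybar xbar ->
  exists2 tau : R, 0 < tau &
    forall y x, graph_deriv q^-1 S ybar xbar y x -> tau * `|x| `^ q <= `|y|.
Proof.
move=> [tau tau0 [U [V [Ux Vy calm]]]]; exists tau => // y x.
move=> [y_ [x_ [t_ [y_y x_x t_gt0 t_0 gS]]]].
have t_r0 : t_ k `^ q^-1 @[k --> \oo] --> 0.
  by apply: cvg0_powR; rewrite ?invr_gt0.
have Vk : \forall k \near \oo, V (ybar + t_ k *: y_ k).
  suff : (ybar + t_ k *: y_ k) @[k --> \oo] --> ybar by exact.
  rewrite -[X in _ --> X]addr0 -(scale0r y).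
  by apply: cvgD; [exact: cvg_cst|exact: cvgZ].
have Uk : \forall k \near \oo, U (xbar + t_ k `^ q^-1 *: x_ k).
  suff : (xbar + t_ k `^ q^-1 *: x_ k) @[k --> \oo] --> xbar by exact.
  rewrite -[X in _ --> X]addr0 -(scale0r x).
  by apply: cvgD; [exact: cvg_cst|exact: cvgZ].
have le_k : \forall k \near \oo, tau * `|x_ k| `^ q <= `|y_ k|.
  near=> k.
  have Vyk : V (ybar + t_ k *: y_ k) by near: k.
  have Uxk : U (xbar + t_ k `^ q^-1 *: x_ k) by near: k.
  have := calm _ _ Vyk (conj (gS k) Uxk).
  (* Since [(t_k^(1/q))^q = t_k], the factor [t_k] cancels from both sides. *)
  rewrite !(addrC _ (_ *: _)) !addrK !normrZ (ger0_norm (powR_ge0 _ _)) (gtr0_norm (t_gt0 k)).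
  have tk_ge0 := ltW (t_gt0 k).
  by rewrite powRM ?powR_ge0// powRqK// mulrCA ler_pM2l.
(* The limit is taken in [|x_k| <= ((|y| + e) / tau)^(1/q)], whose right side is constant, so only
   monotonicity of powers is used. *)
apply/ler_addgt0Pr => e e0; rewrite mulrC -ler_pdivlMr//.
have ye0 : 0 <= (`|y| + e) / tau.
  by apply: divr_ge0; [apply: addr_ge0|]; rewrite // ltW.
rewrite -[leRHS]powRqK//; apply: ge0_ler_powR; rewrite ?nnegrE ?powR_ge0//.
apply: (cvgr_to_le (cvg_norm x_x)); near=> k.
rewrite -[leLHS]powRKq//; apply: ge0_ler_powR; rewrite ?nnegrE ?powR_ge0//.
rewrite ler_pdivlMr// mulrC.
have /le_trans : tau * `|x_ k| `^ q <= `|y_ k| by near: k.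
apply; near: k; apply: (cvgr_le _ (cvg_norm y_y)).
by rewrite ltrDl.
Unshelve. all: by end_near. Qed.

Lemma isolated_calmness_outer_norm :
  isolated_calmness q S ybar xbar ->
  (outer_norm q^-1 (graph_deriv q^-1 S ybar xbar) < +oo)%E.
Proof.
move=> /isolated_calmness_graph_deriv[tau tau0 tauP].
apply: (@le_lt_trans _ _ ((tau^-1 `^ q^-1)%:E)%E); last exact: ltry.
apply: ge_ereal_sup => _ [->|[[y x] [/= /tauP le_xy yx0] <-]].
  by rewrite lee_fin powR_ge0.
have le_x : `|x| <= tau^-1 `^ q^-1 * `|y| `^ q^-1.
  have tauV_ge0 : 0 <= tau^-1 by rewrite invr_ge0 ltW.
  rewrite -powRM// -[leLHS]powRKq//.
  apply: ge0_ler_powR; rewrite ?nnegrE ?powR_ge0 ?mulr_ge0//.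
  by rewrite ler_pdivlMl.
(* At [y = 0] the estimate forces [x = 0], the excluded pair; so no quotient is infinite. *)
have y0 : y != 0.
  apply/eqP => y0; apply: yx0; rewrite y0; congr (_, _).
  move: le_x; rewrite y0 normr0 powR0 ?invr_eq0// mulr0 normr_le0.
  by move/eqP.
have y_gt0 : 0 < `|y| `^ q^-1 by rewrite powR_gt0 ?normr_gt0.
by rewrite inver gt_eqF// -EFinM lee_fin ler_pdivrMr.
Qed.

Lemma graph_deriv00 : gph S (ybar, xbar) ->
  graph_deriv q^-1 S ybar xbar 0 0.
Proof.
move=> Syx; exists (fun=> 0), (fun=> 0), harmonic; split => //.
- exact: cvg_cst.
- exact: cvg_cst.
- by move=> k; rewrite /harmonic /= invr_gt0.
- exact: cvg_harmonic.
- by move=> k; rewrite !scaler0 !addr0.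
Qed.

Lemma outer_norm_lty_graph_deriv0 : gph S (ybar, xbar) ->
  (outer_norm q^-1 (graph_deriv q^-1 S ybar xbar) < +oo)%E ->
  graph_deriv q^-1 S ybar xbar 0 = [set 0].
Proof.
move=> Syx fin; rewrite predeqE => x; split => [Dx|->]; last exact: graph_deriv00.
apply: contrapT => /eqP x0; move: fin; rewrite ltNge => /negP; apply.
apply: ereal_sup_ubound; right; exists (0, x).
  by split => // -[]; exact/eqP.
rewrite /= normr0 powR0 ?invr_eq0// inver eqxx.
by rewrite gt0_muley// lte_fin normr_gt0.
Qed.

(* If calmness fails, then [(y_k, x_k)] in [gph S] tend to [(ybar, xbar)] with
   [|y_k - ybar| = o(|x_k - xbar|^q)].  With [t_k := |x_k - xbar|^q], any limit
   point of the directions [(x_k - xbar) / t_k^(1/q)], which lie on the compact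
   unit sphere, is in the graphical derivative at [0]. *)
Lemma graph_deriv0_isolated_calmness : finite_dim X ->
  graph_deriv q^-1 S ybar xbar 0 = [set 0] -> isolated_calmness q S ybar xbar.
Proof.
move=> /finite_dim_sphere_compact cX D0; apply: contrapT => ncalm.
have /choice[p pP] k : exists p : Y * X, [/\ S p.1 p.2,
    `|p.2 - xbar| < k.+1%:R^-1 &
    `|p.1 - ybar| < k.+1%:R^-1 * `|p.2 - xbar| `^ q].
  apply: contrapT => nok; apply: ncalm; exists k.+1%:R^-1; first by rewrite invr_gt0.
  (* The whole space serves as [V]: a violated inequality itself bounds [|y - ybar|] by
     [|x - xbar|^q / (k+1)]. *)
  exists (ball xbar k.+1%:R^-1), setT.
  split => [||y x _ [Sx Ux]]; [|exact: filterT|].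
    by apply: nbhsx_ballx; rewrite invr_gt0.
  rewrite leNgt; apply/negP => lt_yx; apply: nok; exists (y, x); split => //=.
  by move: Ux; rewrite -ball_normE /= distrC.
pose d k := `|(p k).2 - xbar|.
have d_gt0 k : 0 < d k.
  (* If [d k] were 0, then [0^q = 0] would make the strict bound on [|y_k - ybar|] read as a norm
     below 0. *)
  have [_ _ lt_yx] := pP k; rewrite lt_neqAle normr_ge0 andbT eq_sym.
  apply: contraTneq lt_yx => dk0; rewrite -/(d k) dk0 powR0// mulr0 -leNgt.
  exact: normr_ge0.
pose t k := d k `^ q.
have t_gt0 k : 0 < t k by rewrite powR_gt0.
pose u k := (d k)^-1 *: ((p k).2 - xbar).
pose v k := (t k)^-1 *: ((p k).1 - ybar).
have u1 k : [set x : X | `|x| = 1] (u k).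
  by rewrite /u /= normrZ normfV (gtr0_norm (d_gt0 k)) mulVf// gt_eqF.
have [l l1 [s s_oo us_l]] := compact_subsequence _ _ _ _ cX u1.
have harmonic_cvg0 (w : nat -> R) : (forall k, `|w k| <= k.+1%:R^-1) -> w @ \oo --> 0.
  move=> w_le; apply/cvgr0Pnorm_lt => e e0; near=> k.
  apply: le_lt_trans (w_le k) _.
  by near: k; exact: near_infty_natSinv_lt (PosNum e0).
have v_0 : v @ \oo --> 0.
  apply/norm_cvg0P; apply: harmonic_cvg0 => k.
  have [_ _ lt_yx] := pP k.
  rewrite normr_id normrZ normfV gtr0_norm// ler_pdivrMl// mulrC; exact: ltW.
have t_0 : t @ \oo --> 0.
  have d_0 : d @ \oo --> 0.
    by apply: harmonic_cvg0 => k; rewrite normr_id; have [_ /ltW] := pP k.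
  exact: cvg0_powR.
have : graph_deriv q^-1 S ybar xbar 0 l.
  exists (v \o s), (u \o s), (t \o s); split => //.
  - exact: cvg_comp s_oo v_0.
  - by move=> k; exact: t_gt0.
  - exact: cvg_comp s_oo t_0.
  (* As [t^(1/q) = d], undoing the rescaling returns exactly the chosen points of the graph. *)
  move=> k; rewrite /gph /= powRKq; last exact: normr_ge0.
  rewrite !scalerA !mulfV ?gt_eqF// !scale1r !(addrC _ (_ - _)) !subrK.
  by have [] := pP (s k).
rewrite D0 => l0; move: l1; rewrite (l0 : l = 0) /= normr0 => /esym/eqP.
by rewrite oner_eq0.
Unshelve. all: by end_near. Qed.

End graphical_derivative.

Theorem corollary3p9 (R : realType) (X Y : normedModType R) (q : R)
    (S : Y -> set X) (ybar : Y) (xbar : X) :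
  0 < q -> gph S (ybar, xbar) ->
  let i := isolated_calmness q S ybar xbar in
  let ii := (outer_norm q^-1 (graph_deriv q^-1 S ybar xbar) < +oo)%E in
  let iii := graph_deriv q^-1 S ybar xbar 0 = [set 0] in
  ((i -> ii) /\ (ii -> iii)) /\
  (finite_dim X -> finite_dim Y -> (i <-> ii) /\ (ii <-> iii)).
Proof.
move=> q0 Syx i ii iii.
have i_ii : i -> ii by exact: isolated_calmness_outer_norm.
have ii_iii : ii -> iii by exact: outer_norm_lty_graph_deriv0.
split=> // fX _.
have iii_i : iii -> i by exact: graph_deriv0_isolated_calmness.
by split; split => // H; [apply: iii_i; exact: ii_iii|apply: i_ii; exact: iii_i].
Qed.
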